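(* Let $(X,\le)$ be a finite poset, $K$ a field, and $\mathcal{J}=J(I(X,K))$ the Jacobson radical of the incidence algebra $I(X,K)$. The elements of the centroid $\Gamma(\mathcal{J})$ are exactly the maps of the form $\varphi_\sigma+\eta$, where $\sigma:X^2_<\to K$ is constant on chains and $\eta:\mathcal{J}\to\mathcal{J}$ is an annihilator-valued linear map.
   Context: The incidence algebra $I(X,K)$ is the associative $K$-algebra with basis $\{e_{xy}: x,y\in X,\ x\le y\}$ and multiplication $e_{xy}\cdot e_{uv}=\delta_{yu}e_{xv}$ ($\delta$ is the Kronecker delta). Its Jacobson radical is $\mathcal{J}=\mathrm{span}_K\{e_{xy}: x<y\}$, regarded as an algebra with product $\cdot$. The centroid $\Gamma(A)$ of an algebra $(A,\cdot)$ is the space of linear maps $\varphi:A\to A$ with $\varphi(a\cdot b)=a\cdot\varphi(b)=\varphi(a)\cdot b$ for all $a,b\in A$. The annihilator is $\mathrm{Ann}(A)=\{a\in A: a\cdot b=b\cdot a=0 \text{ for all } b\in A\}$. A linear map $\eta:A\to A$ is annihilator-valued if $\eta(A)\subseteq\mathrm{Ann}(A)$ and $\eta(A\cdot A)=\{0\}$, where $A\cdot A=\mathrm{span}_K\{a\cdot b: a,b\in A\}$. $X^2_<=\{(x,y)\in X^2: x<y\}$. A chain in $X$ is a nonempty subset of pairwise comparable elements. A map $\sigma:X^2_<\to K$ is constant on chains if $\sigma(x,y)=\sigma(u,v)$ whenever $x<y$ and $u<v$ belong to a same chain in $X$. For such $\sigma$, $\varphi_\sigma:\mathcal{J}\to\mathcal{J}$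 is the linear map with $\varphi_\sigma(e_{xy})=\sigma(x,y)e_{xy}$ for all $x<y$. *)

(* Defs.v *)
From HB Require Import structures.
From mathcomp Require Import all_boot all_order all_algebra.

Set Implicit Arguments.
Unset Strict Implicit.
Unset Printing Implicit Defensive.

Import Order.TTheory GRing.Theory.
Local Open Scope ring_scope.

(* Non-unital algebras, given as a finite-dimensional vector space [A] with a
   multiplication [mul]. *)
Section NonUnitalAlgebra.
Variables (K : fieldType) (A : vectType K) (mul : A -> A -> A).

Definition centroid (phi : 'End(A)) : Prop :=
  forall a b : A, phi (mul a b) = mul a (phi b) /\
                  phi (mul a b) = mul (phi a) b.

Definition annihilator (a : A) : Prop :=
  forall b : A, mul a b = 0 /\ mul b a = 0.

Definition in_square (c : A) : Prop :=
  exists (n : nat) (k : 'I_n -> K) (a b : 'I_n -> A),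
    c = \sum_(i < n) k i *: mul (a i) (b i).

Definition annihilator_valued (eta : 'End(A)) : Prop :=
  (forall a : A, annihilator (eta a)) /\
  (forall c : A, in_square c -> eta c = 0).

End NonUnitalAlgebra.

Section IncidenceAlgebra.
Variables (d : Order.disp_t) (X : finPOrderType d) (K : fieldType).

Definition pair_le : Type := {p : X * X | (p.1 <= p.2)%O}.
Definition pair_lt : Type := {p : X * X | (p.1 < p.2)%O}.

(* An alias, so that the product below is not the pointwise one of ffuns. *)
Definition incidence : Type := {ffun pair_le -> K^o}.
HB.instance Definition _ := Vector.copy incidence {ffun pair_le -> K^o}.

(* Junk value: [inc_e x y] is 0 unless x <= y. *)
Definition inc_e (x y : X) : incidence :=
  [ffun p : pair_le => (val p == (x, y))%:R].

(* The bilinear extension of e_xy * e_uv = delta_yu e_xv. *)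
Definition inc_mul (f g : incidence) : incidence :=
  \sum_(p : pair_le) \sum_(q : pair_le)
    (f p * g q * ((val p).2 == (val q).1)%:R) *: inc_e (val p).1 (val q).2.

Definition inc_one : incidence := \sum_(x : X) inc_e x x.

Definition inc_coef (f : incidence) (x y : X) : K := oapp f 0 (insub (x, y)).

Lemma inc_coefE f (p : pair_le) : inc_coef f (val p).1 (val p).2 = f p.
Proof. by rewrite /inc_coef -surjective_pairing valK. Qed.

Lemma inc_coefP f g : (forall x y, inc_coef f x y = inc_coef g x y) -> f = g.
Proof. by move=> fg; apply/ffunP => p; rewrite -!inc_coefE fg. Qed.

Lemma inc_coef_nle f x y : ~~ (x <= y)%O -> inc_coef f x y = 0.
Proof. by move=> xy; rewrite /inc_coef insubN. Qed.

Lemma inc_coefD f g x y : inc_coef (f + g) x y = inc_coef f x y + inc_coef g x y.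
Proof.
rewrite /inc_coef; case: insubP => [p _ _|_] /=; first by rewrite ffunE.
by rewrite addr0.
Qed.

Lemma inc_coefZ a f x y : inc_coef (a *: f) x y = a * inc_coef f x y.
Proof.
rewrite /inc_coef; case: insubP => [p _ _|_] /=; first by rewrite ffunE.
by rewrite mulr0.
Qed.

Lemma inc_coef0 x y : inc_coef 0 x y = 0.
Proof. by rewrite -(scale0r 0) inc_coefZ mul0r. Qed.

Lemma inc_coef_sum I (r : seq I) (P : pred I) (F : I -> incidence) x y :
  inc_coef (\sum_(i <- r | P i) F i) x y =
    \sum_(i <- r | P i) inc_coef (F i) x y.
Proof.
apply: (big_morph (fun f => inc_coef f x y)) => [f g|]; last exact: inc_coef0.
exact: inc_coefD.
Qed.

Lemma inc_coef_e u v x y :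
  inc_coef (inc_e u v) x y = ((x <= y)%O && ((x, y) == (u, v)))%:R.
Proof.
rewrite /inc_coef; case: insubP => [p /= xy vp|/= /negbTE->] //=.
by rewrite xy ffunE; congr (_ == _)%:R.
Qed.

Lemma inc_coef1 x y : inc_coef inc_one x y = (x == y)%:R.
Proof.
rewrite inc_coef_sum (bigD1 x) //= big1 => [|z zx]; rewrite inc_coef_e xpair_eqE.
  by rewrite addr0 eqxx /= eq_sym; case: eqVneq => [->|]; rewrite ?lexx ?andbF.
by rewrite (eq_sym x) (negbTE zx) andbF.
Qed.

Lemma sum_le_pair (F : X * X -> K) :
  (forall p, ~~ (p.1 <= p.2)%O -> F p = 0) ->
  \sum_(p : pair_le) F (val p) = \sum_x \sum_y F (x, y).
Proof.
move=> F0; rewrite pair_bigA /= (bigID (fun p : X * X => p.1 <= p.2)%O) /=.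
rewrite [X in _ + X]big1 ?addr0; last by case=> x y /F0.
rewrite [RHS](reindex_omap (val : pair_le -> _) insub); last first.
  by move=> p pp; rewrite insubT.
by apply: eq_big => [p|p _]; rewrite ?valK ?eqxx ?(valP p) // -surjective_pairing.
Qed.

Lemma inc_coefM f g x y :
  inc_coef (inc_mul f g) x y = \sum_z inc_coef f x z * inc_coef g z y.
Proof.
rewrite inc_coef_sum.
pose F (p q : X * X) := inc_coef f p.1 p.2 * inc_coef g q.1 q.2 *
   (p.2 == q.1)%:R * inc_coef (inc_e p.1 q.2) x y.
transitivity (\sum_(p : pair_le) \sum_(q : pair_le) F (val p) (val q)).
  apply: eq_bigr => p _; rewrite inc_coef_sum; apply: eq_bigr => q _.
  by rewrite inc_coefZ /F !inc_coefE.
rewrite (sum_le_pair (F := fun p => \sum_(q : pair_le) F p (val q))); last first.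
  by move=> p np; rewrite big1 // => q _; rewrite /F inc_coef_nle // !mul0r.
transitivity (\sum_u \sum_z \sum_w \sum_v F (u, z) (w, v)).
  apply: eq_bigr => u _; apply: eq_bigr => z _; apply: sum_le_pair => q nq.
  by rewrite /F (inc_coef_nle g nq) mulr0 !mul0r.
rewrite (bigD1 x) //= addrC big1 ?add0r => [|u ux]; last first.
  do 3![rewrite big1 // => ? _]; rewrite /F inc_coef_e xpair_eqE.
  by rewrite (eq_sym x) (negbTE ux) andbF mulr0.
apply: eq_bigr => z _.
rewrite (bigD1 z) //= addrC big1 ?add0r => [|w wz]; last first.
  by rewrite big1 // => v _; rewrite /F /= (eq_sym z) (negbTE wz) mulr0 mul0r.
rewrite (bigD1 y) //= addrC big1 ?add0r => [|v vy]; last first.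
  by rewrite /F inc_coef_e xpair_eqE (eq_sym y) (negbTE vy) !andbF mulr0.
rewrite /F /= inc_coef_e !eqxx andbT mulr1.
have [_|nxy] := boolP (x <= y)%O; first by rewrite mulr1.
rewrite mulr0; have [xz|nxz] := boolP (x <= z)%O.
  rewrite (inc_coef_nle g) ?mulr0 //.
  by apply: contra nxy; apply: le_trans.
by rewrite (inc_coef_nle f) ?mul0r.
Qed.

Fact inc_mulA : associative inc_mul.
Proof.
move=> f g h; apply: inc_coefP => x y; rewrite !inc_coefM.
under eq_bigr do rewrite inc_coefM mulr_sumr.
rewrite exchange_big /=; apply: eq_bigr => z _.
by rewrite inc_coefM mulr_suml; apply: eq_bigr => w _; rewrite mulrA.
Qed.

Fact inc_mul1l : left_id inc_one inc_mul.
Proof.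
move=> f; apply: inc_coefP => x y; rewrite inc_coefM (bigD1 x) //=.
rewrite inc_coef1 eqxx mul1r big1 ?addr0 // => z zx.
by rewrite inc_coef1 eq_sym (negbTE zx) mul0r.
Qed.

Fact inc_mul1r : right_id inc_one inc_mul.
Proof.
move=> f; apply: inc_coefP => x y; rewrite inc_coefM (bigD1 y) //=.
rewrite inc_coef1 eqxx mulr1 big1 ?addr0 // => z zy.
by rewrite inc_coef1 (negbTE zy) mulr0.
Qed.

Fact inc_mulDl : left_distributive inc_mul +%R.
Proof.
move=> f g h; apply: inc_coefP => x y; rewrite inc_coefD !inc_coefM -big_split.
by apply: eq_bigr => z _; rewrite inc_coefD mulrDl.
Qed.

Fact inc_mulDr : right_distributive inc_mul +%R.
Proof.
move=> f g h; apply: inc_coefP => x y; rewrite inc_coefD !inc_coefM -big_split.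
by apply: eq_bigr => z _; rewrite inc_coefD mulrDr.
Qed.

HB.instance Definition _ := GRing.Zmodule_isPzRing.Build incidence
  inc_mulA inc_mul1l inc_mul1r inc_mulDl inc_mulDr.

Fact inc_scaleAl (a : K) (f g : incidence) : a *: (f * g) = (a *: f) * g.
Proof.
apply: inc_coefP => x y; rewrite inc_coefZ !inc_coefM mulr_sumr.
by apply: eq_bigr => z _; rewrite inc_coefZ mulrA.
Qed.

Fact inc_scaleAr (a : K) (f g : incidence) : a *: (f * g) = f * (a *: g).
Proof.
apply: inc_coefP => x y; rewrite inc_coefZ !inc_coefM mulr_sumr.
by apply: eq_bigr => z _; rewrite inc_coefZ mulrCA.
Qed.

Lemma inc_eM x y u v : (x <= y)%O -> (u <= v)%O ->
  inc_e x y * inc_e u v = (y == u)%:R *: inc_e x v.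
Proof.
move=> xy uv; apply: inc_coefP => a b; rewrite inc_coefM inc_coefZ inc_coef_e.
rewrite (bigD1 y) //= big1 ?addr0 => [|z zy]; last first.
  by rewrite inc_coef_e xpair_eqE (negbTE zy) !andbF mul0r.
rewrite !inc_coef_e !xpair_eqE eqxx andbT.
case: (eqVneq a x) => [->|]; last by rewrite !andbF mul0r mulr0.
case: (eqVneq b v) => [->|]; last by rewrite !andbF !mulr0.
case: (eqVneq y u) uv => [<- yv|_ _]; last by rewrite !andbF mulr0 mul0r.
by rewrite xy yv (le_trans xy yv) !mulr1.
Qed.

Lemma inc_coefM_diag (f g : incidence) x :
  inc_coef (f * g) x x = inc_coef f x x * inc_coef g x x.
Proof.
rewrite inc_coefM (bigD1 x) //= big1 ?addr0 // => z nzx.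
have [xz|/inc_coef_nle->] := boolP (x <= z)%O; last by rewrite mul0r.
have [zx|/inc_coef_nle->] := boolP (z <= x)%O; last by rewrite mulr0.
by rewrite (le_anti (x := z) (y := x)) ?zx ?eqxx in nzx.
Qed.

(* [jacP] identifies this span with the Jacobson radical. *)
Definition jac_space : {vspace incidence} :=
  <<[seq inc_e (val p).1 (val p).2 | p : pair_lt]>>%VS.

Lemma mem_jac f : (f \in jac_space) <-> (forall x, inc_coef f x x = 0).
Proof.
split=> [|f0].
  rewrite /jac_space; set s := image _ _ => /coord_span-> x.
  rewrite inc_coef_sum big1 // => i _; rewrite inc_coefZ.
  have /imageP[p _ ->] : s`_i \in s by rewrite mem_nth // size_image.
  rewrite inc_coef_e xpair_eqE; case: eqP => [->|]; last by rewrite andbF mulr0.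
  by rewrite (lt_eqF (valP p)) !andbF mulr0.
have -> : f = \sum_(p : pair_le) f p *: inc_e (val p).1 (val p).2.
  apply/ffunP => q; rewrite sum_ffunE (bigD1 q) //= big1 ?addr0 => [|p pq].
    by rewrite !ffunE -surjective_pairing eqxx; apply/esym/mulr1.
  rewrite !ffunE -surjective_pairing eq_sym val_eqE (negbTE pq).
  exact: mulr0.
apply: memv_suml => p _; have [lt_p|] := boolP ((val p).1 < (val p).2)%O.
  apply/memvZ/memv_span/imageP.
  by exists (exist (fun p : X * X => p.1 < p.2)%O (val p) lt_p).
rewrite lt_neqAle (valP p) andbT negbK => /eqP p12.
by rewrite -inc_coefE -p12 f0 scale0r mem0v.
Qed.

(* [f] lies in the Jacobson radical of a unital ring iff every 1 - a f is left
   invertible. *)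
Lemma jacP f :
  (f \in jac_space) <-> (forall a : incidence, exists b, b * (1 - a * f) = 1).
Proof.
split=> [/mem_jac f0 a|f_inv].
  pose g := a * f; pose h (x : X) := #|[set z | z < x]%O|.
  have g0 x : inc_coef g x x = 0 by rewrite inc_coefM_diag f0 mulr0.
  have h_lt x y : (x < y)%O -> (h x < h y)%N.
    move=> xy; apply/proper_card/properP; split.
      by apply/subsetP => z; rewrite !inE => /lt_trans; apply.
    by exists x; rewrite !inE ?ltxx.
  have gX n x y : (h y < h x + n)%N -> inc_coef (g ^+ n) x y = 0.
    elim: n x y => [|n IHn] x y hxy.
      rewrite expr0 inc_coef1; case: eqP => // exy.
      by rewrite exy addn0 ltnn in hxy.
    rewrite exprS inc_coefM big1 // => z _.
    have [xz|/inc_coef_nle->] := boolP (x <= z)%O; last by rewrite mul0r.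
    case: (eqVneq x z) => [<-|nxz]; first by rewrite g0 mul0r.
    rewrite IHn ?mulr0 // (leq_trans hxy) // addnS -addSn leq_add2r.
    by apply: h_lt; rewrite lt_neqAle nxz.
  have gN : g ^+ #|X|.+1 = 0.
    apply: inc_coefP => x y; rewrite inc_coef0 gX //.
    by rewrite addnS ltnS (leq_trans (max_card _)) // leq_addl.
  exists (\sum_(i < #|X|.+1) g ^+ i).
  set b := \sum_(i < _) _; have <- : (1 - g) * b = b * (1 - g).
    apply/commr_sum => i _; apply/commrX/commr_sym/commrB; last exact: commr_refl.
    exact: commr1.
  by rewrite -[1 - g]opprB mulNr -subrX1 gN sub0r opprK.
apply/mem_jac => x; apply/eqP; apply: contraT => fx.
have [b /(congr1 (fun u => inc_coef u x x))] :=
  f_inv ((inc_coef f x x)^-1 *: inc_e x x).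
rewrite inc_coef1 eqxx inc_coefM_diag inc_coefD -scaleN1r inc_coefZ inc_coef1.
rewrite inc_coefM_diag inc_coefZ inc_coef_e lexx !eqxx mulr1 mulVf // mulr1.
by rewrite subrr mulr0 => /esym/eqP; rewrite oner_eq0.
Qed.

Lemma jacM (f g : incidence) :
  f \in jac_space -> g \in jac_space -> f * g \in jac_space.
Proof.
move=> /mem_jac f0 /mem_jac g0; apply/mem_jac => x.
by rewrite inc_coefM_diag f0 mul0r.
Qed.

Definition jac : vectType K := subvs_of jac_space.

Definition jac_mul (f g : jac) : jac :=
  Subvs (jacM (subvsP f) (subvsP g)).

Fact jac_e_subproof (p : pair_lt) : inc_e (val p).1 (val p).2 \in jac_space.
Proof. exact/memv_span/image_f. Qed.

Definition jac_e (p : pair_lt) : jac := Subvs (jac_e_subproof p).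

Definition chain (C : {set X}) : Prop :=
  C != set0 /\ {in C &, forall x y, (x >=< y)%O}.

Definition constant_on_chains (sigma : pair_lt -> K) : Prop :=
  forall (p q : pair_lt) (C : {set X}), chain C ->
    (val p).1 \in C -> (val p).2 \in C -> (val q).1 \in C -> (val q).2 \in C ->
    sigma p = sigma q.

Definition phi_fun (sigma : pair_lt -> K) (f : jac) : jac :=
  \sum_(p : pair_lt)
    (inc_coef (vsval f) (val p).1 (val p).2 * sigma p) *: jac_e p.

Fact phi_fun_is_linear sigma : linear (phi_fun sigma).
Proof.
move=> a f g; rewrite scaler_sumr -big_split; apply: eq_bigr => p _ /=.
by rewrite inc_coefD inc_coefZ scalerA mulrA -scalerDl mulrDl.
Qed.
HB.instance Definition _ sigma :=
  GRing.isLinear.Build K jac jac _ (phi_fun sigma) (phi_fun_is_linear sigma).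

Definition phi_sigma (sigma : pair_lt -> K) : 'End(jac) := linfun (phi_fun sigma).

Lemma phi_sigma_e sigma p : phi_sigma sigma (jac_e p) = sigma p *: jac_e p.
Proof.
rewrite lfunE /= /phi_fun (bigD1 p) //= big1 ?addr0 => [|q qp].
  by rewrite inc_coef_e (ltW (valP p)) -surjective_pairing eqxx mul1r.
rewrite inc_coef_e -!surjective_pairing val_eqE (negbTE qp) andbF mul0r.
exact: scale0r.
Qed.

End IncidenceAlgebra.

(* Main.v *)
Require Import Defs.
From mathcomp Require Import all_boot all_order all_algebra.

Set Implicit Arguments.
Unset Strict Implicit.
Unset Printing Implicit Defensive.

Import Order.TTheory GRing.Theory.
Local Open Scope ring_scope.

(* If x < y < z, then phi (e_xz) = phi (e_xy) e_yz = e_xy phi (e_yz), for phi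
   in the centroid. The middle term is supported in column z and the last one
   in row x, so both are multiples of e_xz, and the multiple is at once the
   coefficient of phi (e_uv) at (u, v) for (u, v) = (x, y), (y, z) and (x, z).
   Taking this coefficient for sigma (u, v) gives a map constant on chains
   such that phi and phi_sigma agree on products and multiply in the same way,
   that is, such that phi - phi_sigma is annihilator-valued. *)

Section Centroid.
Variables (d : Order.disp_t) (X : finPOrderType d) (K : fieldType).
Local Notation jac := (jac X K).
Local Notation pair_lt := (pair_lt X).
Local Notation E := (jac_e K).
Implicit Types (a b f g : jac) (p q r : pair_lt) (sigma : pair_lt -> K).

Local Notation "a ** b" := (jac_mul a b) (at level 40, left associativity).

(** * Bilinearity of the product and induction on the basis of the radical *)

Definition pair_lt_of (x y : X) (xy : (x < y)%O) : pair_lt :=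
  exist (fun p : X * X => p.1 < p.2)%O (x, y) xy.

Lemma jac_mulDl a b f : (a + b) ** f = a ** f + b ** f.
Proof. by apply: val_inj; rewrite /= mulrDl. Qed.

Lemma jac_mulDr f a b : f ** (a + b) = f ** a + f ** b.
Proof. by apply: val_inj; rewrite /= mulrDr. Qed.

Lemma jac_mulZl (k : K) a b : (k *: a) ** b = k *: (a ** b).
Proof. by apply: val_inj; rewrite /= inc_scaleAl. Qed.

Lemma jac_mulZr (k : K) a b : a ** (k *: b) = k *: (a ** b).
Proof. by apply: val_inj; rewrite /= inc_scaleAr. Qed.

Lemma jac_mul0l a : 0 ** a = 0.
Proof. by apply: val_inj; rewrite /= mul0r. Qed.

Lemma jac_mul0r a : a ** 0 = 0.
Proof. by apply: val_inj; rewrite /= mulr0. Qed.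

Lemma jac_ind (P : jac -> Prop) :
    P 0 -> (forall (k : K) a b, P a -> P b -> P (k *: a + b)) ->
    (forall p, P (E p)) -> forall a, P a.
Proof.
move=> P0 PD PE a.
suff -> : a = \sum_(p : pair_lt) inc_coef (vsval a) (val p).1 (val p).2 *: E p.
  by elim/big_rec: _ => // p b _; apply: PD.
apply: val_inj; apply: inc_coefP => x y.
rewrite linear_sum inc_coef_sum.
(* Unless [x < y], both coefficients vanish: that of [a] on the diagonal because [a] lies in the
   radical, and elsewhere by the default value of [inc_coef]. *)
have [xy|nxy] := boolP (x < y)%O; last first.
  have -> : inc_coef (vsval a) x y = 0.
    case: (eqVneq x y) nxy => [<- _|xNy]; first by have /mem_jac := subvsP a.
    by rewrite lt_neqAle xNy => /inc_coef_nle->.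
  rewrite big1 // => p _; rewrite linearZ /= inc_coefZ inc_coef_e xpair_eqE.
  case: eqP nxy => [->|]; last by rewrite andbF mulr0.
  by case: eqP => [->|]; [rewrite (valP p) | rewrite !andbF mulr0].
rewrite (bigD1 (pair_lt_of xy)) // big1 => [|p pxy].
  by rewrite linearZ inc_coefZ /= inc_coef_e (ltW xy) eqxx mulr1 addr0.
rewrite linearZ inc_coefZ /= inc_coef_e -surjective_pairing.
have /negbTE -> : (x, y) != val p by rewrite eq_sym.
by rewrite andbF mulr0.
Qed.

Lemma jac_ind2 (P : jac -> jac -> Prop) :
    (forall b, P 0 b) -> (forall a, P a 0) ->
    (forall (k : K) a b f, P a f -> P b f -> P (k *: a + b) f) ->
    (forall (k : K) f a b, P f a -> P f b -> P f (k *: a + b)) ->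
    (forall p q, P (E p) (E q)) -> forall a b, P a b.
Proof.
move=> P0l P0r PDl PDr PE a b; elim/jac_ind: a => // [k f g|p].
  exact: PDl.
by elim/jac_ind: b => // k f g; apply: PDr.
Qed.

(** * Products of basis elements *)

Lemma jac_mul_e p q r :
    (val p).2 = (val q).1 -> val r = ((val p).1, (val q).2) ->
  E p ** E q = E r.
Proof.
move=> pq rE; apply: val_inj; rewrite /= rE /= inc_eM ?(ltW (valP p)) ?(ltW (valP q)) //.
by rewrite pq eqxx scale1r.
Qed.

Lemma jac_mul_e0 p q : (val p).2 != (val q).1 -> E p ** E q = 0.
Proof.
move=> pq; apply: val_inj; rewrite /= inc_eM ?(ltW (valP p)) ?(ltW (valP q)) //.
by rewrite (negbTE pq) scale0r.
Qed.

(** In the nonzero case [r] is pinned down by an equation on its value, so that no particular proof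
    of its strict inequality has to be carried along. *)
Variant jac_mul_e_spec p q : jac -> Prop :=
| JacMulE0 of (val p).2 != (val q).1 : jac_mul_e_spec p q 0
| JacMulE r of (val p).2 = (val q).1 & val r = ((val p).1, (val q).2) :
    jac_mul_e_spec p q (E r).

Lemma jac_mul_eP p q : jac_mul_e_spec p q (E p ** E q).
Proof.
have [pq|/[dup] pq /jac_mul_e0 ->] := eqVneq (val p).2 (val q).1; last first.
  by constructor.
have pq_lt : ((val p).1 < (val q).2)%O.
  by rewrite (lt_trans (valP p)) // pq (valP q).
by rewrite (jac_mul_e (r := pair_lt_of pq_lt)) //; constructor.
Qed.

(** * Constancy on chains in terms of composable pairs *)

Definition constant_on_triples sigma : Prop := forall p q r,
  (val p).2 = (val q).1 -> val r = ((val p).1, (val q).2) ->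
  sigma p = sigma r /\ sigma q = sigma r.

(** A composable triple spans a chain of three elements. Conversely, two pairs with one endpoint in
    common and the other endpoints comparable are equal or belong to a triple, and any two pairs in
    a chain are joined by two such moves. *)
Lemma constant_on_chainsP sigma :
  constant_on_chains sigma <-> constant_on_triples sigma.
Proof.
split=> [cst p q r pq rE|cst].
  have C3 : chain [set (val p).1; (val p).2; (val q).2].
    split; first by apply/set0Pn; exists (val p).1; rewrite !inE eqxx.
    have lt1 := valP p; have lt2 := valP q; rewrite /= -pq in lt1 lt2.
    have lt3 := lt_trans lt1 lt2.
    move=> x y; rewrite !inE -!orbA => /or3P[] /eqP -> /or3P[] /eqP ->;
      by rewrite /Order.comparable ?lexx ?(ltW lt1) ?(ltW lt2) ?(ltW lt3) ?orbT.
  by split; apply: (cst _ _ _ C3); rewrite ?rE -?pq !inE eqxx ?orbT.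
have same_left p q : (val p).1 = (val q).1 -> ((val p).2 >=< (val q).2)%O ->
    sigma p = sigma q.
  wlog le_pq : p q / ((val p).2 <= (val q).2)%O => [H pq1 pq2|pq1 _].
    by case/orP: (pq2) => ?; [|symmetry]; apply: H; rewrite // comparable_sym.
  have [pq2|ne_pq] := eqVneq (val p).2 (val q).2.
    congr sigma; apply: val_inj.
    by rewrite (surjective_pairing (val p)) pq1 pq2 -surjective_pairing.
  have lt_pq : ((val p).2 < (val q).2)%O by rewrite lt_neqAle ne_pq.
  have [] // := cst p (pair_lt_of lt_pq) q _ _.
  by rewrite /= pq1 -surjective_pairing.
have same_right p q : (val p).2 = (val q).2 -> ((val p).1 >=< (val q).1)%O ->
    sigma p = sigma q.
  wlog le_pq : p q / ((val p).1 <= (val q).1)%O => [H pq1 pq2|pq2 _].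
    by case/orP: (pq2) => ?; [|symmetry]; apply: H; rewrite // comparable_sym.
  have [pq1|ne_pq] := eqVneq (val p).1 (val q).1.
    congr sigma; apply: val_inj.
    by rewrite (surjective_pairing (val p)) pq1 pq2 -surjective_pairing.
  have lt_pq : ((val p).1 < (val q).1)%O by rewrite lt_neqAle ne_pq.
  have [] // := cst (pair_lt_of lt_pq) q p _ _.
  by rewrite /= -pq2 -surjective_pairing.
move=> p q C [_ cC] p1 p2 q1 q2.
wlog le_pq : p q p1 p2 q1 q2 / ((val p).1 <= (val q).1)%O => [H|].
  by case/orP: (cC _ _ p1 q1) => ?; [|symmetry]; apply: H.
(* The intermediate pair [((val p).1, (val q).2)] shares its left end with [p] and its right end
   with [q]. *)
have pq_lt := le_lt_trans le_pq (valP q).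
rewrite (same_left p (pair_lt_of pq_lt)) //; last exact: cC.
by apply: same_right => //; apply: cC.
Qed.

(** * Both kinds of summands lie in the centroid *)

Lemma phi_sigma_mul_e sigma p q : constant_on_chains sigma ->
  phi_sigma sigma (E p ** E q) = sigma p *: (E p ** E q) /\
  phi_sigma sigma (E p ** E q) = sigma q *: (E p ** E q).
Proof.
move=> /constant_on_chainsP cst; case: jac_mul_eP => [_|r pq rE].
  by rewrite linear0 !scaler0.
by rewrite phi_sigma_e; have [-> ->] := cst _ _ _ pq rE.
Qed.

Lemma centroid_by_e (phi : 'End(jac)) :
    (forall p q, phi (E p ** E q) = E p ** phi (E q) /\
                 phi (E p ** E q) = phi (E p) ** E q) ->
  centroid (@jac_mul d X K) phi.
Proof.
move=> phiE; apply: jac_ind2 => //.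
- by move=> b; rewrite linear0 !jac_mul0l linear0.
- by move=> a; rewrite linear0 !jac_mul0r linear0.
- move=> k a b f [a1 a2] [b1 b2].
  rewrite jac_mulDl jac_mulZl !linearP !jac_mulDl !jac_mulZl.
  by rewrite -a1 -a2 -b1 -b2.
- move=> k f a b [a1 a2] [b1 b2].
  rewrite jac_mulDr jac_mulZr !linearP !jac_mulDr !jac_mulZr.
  by rewrite -a1 -a2 -b1 -b2.
Qed.

Lemma phi_sigma_centroid sigma : constant_on_chains sigma ->
  centroid (@jac_mul d X K) (phi_sigma sigma).
Proof.
move=> cst; apply: centroid_by_e => p q.
by rewrite !phi_sigma_e jac_mulZl jac_mulZr; have [] := phi_sigma_mul_e p q cst.
Qed.

(** All three terms of the centroid identity are zero: [eta] kills products, and its values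
    annihilate everything. *)
Lemma annihilator_valued_centroid (eta : 'End(jac)) :
  annihilator_valued (@jac_mul d X K) eta -> centroid (@jac_mul d X K) eta.
Proof.
move=> [eta_ann eta_sq] a b.
have [_ ->] := eta_ann b a; have [-> _] := eta_ann a b.
rewrite eta_sq //; exists 1%N, (fun=> 1), (fun=> a), (fun=> b).
by rewrite big_ord1 scale1r.
Qed.

Lemma centroidD (phi psi : 'End(jac)) :
  centroid (@jac_mul d X K) phi -> centroid (@jac_mul d X K) psi ->
  centroid (@jac_mul d X K) (phi + psi).
Proof.
move=> phiP psiP a b; rewrite !add_lfunE jac_mulDl jac_mulDr.
by have [<- <-] := phiP a b; have [<- <-] := psiP a b.
Qed.

(** * The diagonal part of a centroid element *)

(** The other coefficients of [phi (E p)] may be nonzero; they are left to the annihilator-valued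
    part. *)
Definition diag_coef (phi : 'End(jac)) p : K :=
  inc_coef (vsval (phi (E p))) (val p).1 (val p).2.

(** Right multiplication by [E q] moves column [(val q).1] to column [(val q).2] and erases all the
    others. *)
Lemma inc_coef_mul_er f q x y :
  inc_coef (vsval (f ** E q)) x y =
  inc_coef (vsval f) x (val q).1 * (y == (val q).2)%:R.
Proof.
rewrite inc_coefM (bigD1 (val q).1) //= big1 ?addr0 => [|z zq].
  rewrite inc_coef_e xpair_eqE eqxx; case: eqP => [->|]; last by rewrite !andbF.
  by rewrite (ltW (valP q)).
by rewrite inc_coef_e xpair_eqE (negbTE zq) andbF mulr0.
Qed.

Lemma inc_coef_mul_el p f x y :
  inc_coef (vsval (E p ** f)) x y =
  (x == (val p).1)%:R * inc_coef (vsval f) (val p).2 y.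
Proof.
rewrite inc_coefM (bigD1 (val p).2) //= big1 ?addr0 => [|z zp].
  rewrite inc_coef_e xpair_eqE eqxx; case: eqP => [->|]; last by rewrite !andbF.
  by rewrite (ltW (valP p)).
by rewrite inc_coef_e xpair_eqE (negbTE zp) !andbF mul0r.
Qed.

Section CentroidElement.
Variable phi : 'End(jac).
Hypothesis phiP : centroid (@jac_mul d X K) phi.
Local Notation sigma := (diag_coef phi).

Lemma centroid_mul_e p q r :
    (val p).2 = (val q).1 -> val r = ((val p).1, (val q).2) ->
  [/\ phi (E r) = sigma r *: E r, sigma p = sigma r & sigma q = sigma r].
Proof.
move=> pq rE; have [phil phir] := phiP (E p) (E q).
rewrite (jac_mul_e pq rE) in phil phir.
have sp : sigma p = sigma r.
  by rewrite [RHS]/diag_coef phir inc_coef_mul_er rE /= eqxx mulr1 -pq.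
have sq : sigma q = sigma r.
  by rewrite [RHS]/diag_coef phil inc_coef_mul_el rE /= eqxx mul1r pq.
split=> //; apply: val_inj; apply: inc_coefP => x y.
rewrite linearZ /= inc_coefZ inc_coef_e rE xpair_eqE /=.
(* Outside row [(val p).1] the form [E p ** phi (E q)] gives zero, and outside column [(val q).2]
   the form [phi (E p) ** E q] does. The one remaining entry is [sigma r] by definition. *)
case: (eqVneq x) => [->|xp]; last first.
  by rewrite phil inc_coef_mul_el (negbTE xp) andbF mul0r mulr0.
case: (eqVneq y) => [->|yq]; last first.
  by rewrite phir inc_coef_mul_er (negbTE yq) !andbF !mulr0.
have := valP r; rewrite /= rE /= => /ltW ->.
by rewrite mulr1 /diag_coef rE.
Qed.

Lemma diag_coef_constant : constant_on_chains sigma.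
Proof.
apply/constant_on_chainsP => p q r pq rE.
by have [] := centroid_mul_e pq rE.
Qed.

Lemma phi_sigma_diag_mul_e p q :
  phi_sigma sigma (E p ** E q) = phi (E p ** E q).
Proof.
case: jac_mul_eP => [|r pq rE]; first by rewrite !linear0.
by have [-> _ _] := centroid_mul_e pq rE; rewrite phi_sigma_e.
Qed.

Lemma phi_sigma_diag_mul a b : phi_sigma sigma (a ** b) = phi (a ** b).
Proof.
move: a b; apply: jac_ind2.
- by move=> b; rewrite jac_mul0l !linear0.
- by move=> a; rewrite jac_mul0r !linear0.
- by move=> k a b f Ea Eb; rewrite jac_mulDl jac_mulZl !linearP /= Ea Eb.
- by move=> k f a b Ea Eb; rewrite jac_mulDr jac_mulZr !linearP /= Ea Eb.
- exact: phi_sigma_diag_mul_e.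
Qed.

(** Both maps are in the centroid and agree on products, so their difference [psi] satisfies
    [psi a ** b = psi (a ** b) = 0], and likewise on the other side. *)
Lemma centroid_sub_annihilator_valued :
  annihilator_valued (@jac_mul d X K) (phi - phi_sigma sigma).
Proof.
have psiP := phi_sigma_centroid diag_coef_constant.
split=> [a b|c [n [k [a [b ->]]]]].
  rewrite add_lfunE opp_lfunE -scaleN1r jac_mulDl jac_mulDr jac_mulZl jac_mulZr.
  have [[_ <-] [<- _]] := (phiP a b, phiP b a).
  have [[_ <-] [<- _]] := (psiP a b, psiP b a).
  by rewrite !phi_sigma_diag_mul !scaleN1r !subrr.
rewrite linear_sum big1 // => i _.
by rewrite linearZ /= add_lfunE opp_lfunE phi_sigma_diag_mul subrr scaler0.
Qed.

End CentroidElement.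

End Centroid.

Theorem proposition4p7 (d : Order.disp_t) (X : finPOrderType d) (K : fieldType)
    (phi : 'End(jac X K)) :
  centroid (@jac_mul d X K) phi <->
  exists (sigma : pair_lt X -> K) (eta : 'End(jac X K)),
    [/\ constant_on_chains sigma,
        annihilator_valued (@jac_mul d X K) eta
      & phi = (phi_sigma sigma + eta)%R].
Proof.
split=> [phiP|[sigma [eta [cst ann ->]]]]; last first.
  apply: centroidD; first exact: phi_sigma_centroid.
  exact: annihilator_valued_centroid.
exists (diag_coef phi), (phi - phi_sigma (diag_coef phi)); split.
- exact: diag_coef_constant.
- exact: centroid_sub_annihilator_valued.
- by rewrite addrC subrK.
Qed.
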